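(* Let $f\in\mathbb{R}[x_1,\dots,x_n]$, $\lambda=(\lambda_1,\dots,\lambda_n)\in\mathbb{R}^n$ and $V\in\mathbb{R}^{n\times n}$. The following are equivalent: (1) $(\lambda,V)$ is a PW-PCA of $f$. (2) $V\operatorname{diag}(\lambda)V^\top$ is an orthogonal eigendecomposition of $\operatorname{Cov}(\overline f)_{1:n,1:n}$ with eigenvalues sorted in non-increasing order; that is, $V$ is an orthogonal matrix, $\lambda_1\ge\dots\ge\lambda_n$, and $\operatorname{Cov}(\overline f)_{1:n,1:n}=V\operatorname{diag}(\lambda)V^\top$.
   Context: Polynomial-weighted variance and covariance: for a homogeneous polynomial $h\in\mathbb{R}[x_1,\dots,x_N]$ and $w\in\mathbb{R}^N$, $\operatorname{Var}_w(h)=\int_{\mathbb{S}^{N-1}} h(x)^2\,(w^\top x)^2\,d\mu(x)$ and $\operatorname{Cov}(h)=\int_{\mathbb{S}^{N-1}}h(x)^2\,xx^\top\,d\mu(x)\in\mathbb{R}^{N\times N}$, where $\mu$ is the (unnormalized surface) spherical measure on the unit sphere $\mathbb{S}^{N-1}\subset\mathbb{R}^N$. Homogenization: for $f\in\mathbb{R}[x_1,\dots,x_n]$, $\overline f(x_1,\dots,x_{n+1})=x_{n+1}^{\deg f}f(x_1/x_{n+1},\dots,x_n/x_{n+1})$. $M_{1:n,1:n}$ denotes the leading principal $n\times n$ submatrix of $M$. PW-PCA: vectors $v_1,\dots,v_n\in\mathbb{R}^n$ are a set of principal axes for $f$ if for each $i=1,\dots,n$, $v_i$ maximizes $u\mapsto\operatorname{Var}_{[u,0]}(\overline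 f)$ over all $u\in\mathbb{R}^n$ with $\|u\|=1$ and $u\perp v_1,\dots,v_{i-1}$ (here $[u,0]\in\mathbb{R}^{n+1}$ is $u$ with a zero appended). The principal variances are $\lambda_i=\operatorname{Var}_{[v_i,0]}(\overline f)$. With $\lambda=(\lambda_1,\dots,\lambda_n)$ and $V$ the matrix with columns $v_1,\dots,v_n$, the pair $(\lambda,V)$ is called a PW-PCA of $f$. *)

(* Defs.v *)
From HB Require Import structures.
From mathcomp Require Import all_boot all_order all_algebra.
From mathcomp.multinomials Require mpoly.

Set Implicit Arguments.
Unset Strict Implicit.
Unset Printing Implicit Defensive.

Import Order.TTheory GRing.Theory Num.Theory.

Local Open Scope ring_scope.

(* [mpoly] cannot be imported together with the analysis library (clashing
   notation levels), hence the module, which confines the import. *)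
Module Homogenization.

Import mpoly.

(* x_{n+1}^deg f * f(x_1/x_{n+1}, ..., x_n/x_{n+1}), expanded on the monomials
   of f; see [homogenizeE]. For f = 0, deg f is taken to be 0. *)
Definition homogenize (R : comNzRingType) (n : nat) (f : {mpoly R[n]}) :
    {mpoly R[n + 1]} :=
  \sum_(m <- msupp f)
    f@_m *: (\prod_(i < n) 'X_(lshift 1 i) ^+ m i
             * 'X_(rshift n ord0) ^+ ((msize f).-1 - mdeg m)).

Lemma homogenizeE (F : fieldType) (n : nat) (f : {mpoly F[n]})
    (x : 'I_(n + 1) -> F) : x (rshift n ord0) != 0 ->
  (homogenize f).@[x] =
    x (rshift n ord0) ^+ (msize f).-1
    * f.@[fun i => x (lshift 1 i) / x (rshift n ord0)].
Proof.
move=> xN0; rewrite /homogenize raddf_sum [in RHS]mevalE mulr_sumr !big_seq.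
apply: eq_bigr => m mf /=; rewrite mevalZ mevalM rmorph_prod rmorphXn /= mevalXU.
rewrite [RHS]mulrCA; congr (_ * _).
under eq_bigr => i _ do rewrite rmorphXn /= mevalXU.
under [in RHS]eq_bigr => i _ do rewrite exprMn exprVn.
rewrite big_split /= mulrCA; congr (_ * _).
rewrite prodfV prodrXr -mdegE expfB_cond //.
rewrite (negbTE xN0) add0n -ltnS.
apply: leq_trans (msize_mdeg_lt mf) _.
exact: leqSpred.
Qed.

Lemma homogenize_homog (R : comNzRingType) (n : nat) (f : {mpoly R[n]}) :
  homogenize f \is (msize f).-1.-homog.
Proof.
rewrite /homogenize big_seq; apply: rpred_sum => m mf; apply: rpredZ.
have le_m : (mdeg m <= (msize f).-1)%N.
  rewrite -ltnS; apply: leq_trans (msize_mdeg_lt mf) (leqSpred _).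
have dX k (j : 'I_(n + 1)) : ('X_j ^+ k : {mpoly R[n + 1]}) \is k.-homog.
  by rewrite mpolyXn dhomogX /= mdegMn mdeg1 mul1n.
set k := (_ - _)%N; have -> : (msize f).-1 = (mdeg m + k)%N by rewrite subnKC.
apply: dhomogM; last exact: dX.
rewrite mdegE.
by elim/big_rec2: _ => [|i d p _ hp]; [exact: dhomog1 | exact: dhomogM].
Qed.

End Homogenization.
Export Homogenization.

From mathcomp Require Import all_classical all_reals all_analysis.
From mathcomp Require Import measurable_realfun.
Import numFieldNormedType.Exports.

Local Open Scope classical_set_scope.

Notation "{ 'mpoly' T [ n ] }" := (mpoly.mpoly n T)
  (at level 0, T, n at level 2, format "{ 'mpoly'  T [ n ] }") : type_scope.

Section EuclideanSpace.
Variable R : realType.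

Definition dot (N : nat) (u v : 'cV[R]_N) : R := (u^T *m v) 0 0.

(* The library's norm on matrices is the sup norm. *)
Definition enorm (N : nat) (v : 'cV[R]_N) : R := Num.sqrt (dot v v).

Definition colv (N : nat) (x : N.-tuple R) : 'cV[R]_N := \col_i tnth x i.

Section ConsMeasure.
Variables (k : nat) (m : {sigma_finite_measure set (k.-tuple R) -> \bar R}).

Definition cons_pair (p : R * k.-tuple R) : k.+1.-tuple R := [tuple of p.1 :: p.2].

Definition cons_measure : set (k.+1.-tuple R) -> \bar R :=
  pushforward (lebesgue_measure \x m)%E cons_pair.

Let measurable_cons_pair : measurable_fun setT cons_pair.
Proof. exact: measurable_cons. Qed.

Let cons0 : cons_measure set0 = 0%E.
Proof. by rewrite /cons_measure /pushforward preimage_set0 measure0. Qed.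

Let cons_ge0 A : (0 <= cons_measure A)%E.
Proof. exact: measure_ge0. Qed.

Let cons_sigma_additive : semi_sigma_additive cons_measure.
Proof.
unshelve refine (@measure_semi_sigma_additive _ _ _
  (pushforward (lebesgue_measure \x m)%E cons_pair)).
exact: measurable_cons_pair.
Qed.

HB.instance Definition _ := isMeasure.Build _ _ _ cons_measure
  cons0 cons_ge0 cons_sigma_additive.

Let cons_sigma_finite : sigma_finite setT cons_measure.
Proof.
have /sigma_finiteP[F [FT ndF Ffin]] := sigma_finiteT (@lebesgue_measure R).
have /sigma_finiteP[G [GT ndG Gfin]] := sigma_finiteT m.
pose uncons (x : k.+1.-tuple R) : R * k.-tuple R :=
  (thead x, [tuple of behead x]).
have cons_pairK : cancel cons_pair uncons.
  by move=> [a x]; rewrite /uncons /=; congr pair; apply: val_inj.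
have muncons : measurable_fun setT uncons.
  apply/measurable_fun_pairP; split; first exact: measurable_tnth.
  exact: measurable_behead.
exists (fun i => uncons @^-1` (F i `*` G i)).
  rewrite predeqE => x; split=> // _.
  have [i _ Fi] : (\bigcup_i F i) (uncons x).1 by rewrite -FT.
  have [j _ Gj] : (\bigcup_i G i) (uncons x).2 by rewrite -GT.
  exists (maxn i j) => //; split.
  - by move: Fi; exact/subsetPset/ndF/leq_maxl.
  - by move: Gj; exact/subsetPset/ndG/leq_maxr.
move=> i; have [mF Ffini] := Ffin i; have [mG Gfini] := Gfin i; split.
  by rewrite -[X in measurable X]setTI; apply: muncons => //; exact: measurableX.
rewrite /cons_measure /pushforward -comp_preimage.
rewrite (_ : uncons \o _ = id); last first.
  by rewrite funeqE => p; rewrite /= cons_pairK.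
rewrite preimage_id product_measure1E //.
by rewrite lte_mul_pinfty // ge0_fin_numE.
Qed.

HB.instance Definition _ := @Measure_isSigmaFinite.Build _ _ _ cons_measure
  cons_sigma_finite.

End ConsMeasure.

(* Lebesgue measure on R^N, as the N-fold product of the one on R. *)
Fixpoint lebesgueN (N : nat) : {sigma_finite_measure set (N.-tuple R) -> \bar R} :=
  match N with
  | 0 => dirac [tuple]
  | k.+1 => cons_measure (lebesgueN k)
  end.

Let measurable_invr : measurable_fun setT (@GRing.inv R).
Proof.
rewrite (_ : @GRing.inv R = fun x => if x == 0 then 0 else x^-1); last first.
  by apply/funext => x; case: eqVneq => // ->; rewrite invr0.
apply: measurable_fun_if => //.
- exact: measurable_fun_eqr.
- rewrite setTI (_ : _ @^-1` _ = [set x : R | x != 0]); last first.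
    by apply/seteqP; split => [x /negbT|x /negbTE].
  apply: open_continuous_measurable_fun => //.
  by apply/in_setP => x /= x0; exact: inv_continuous.
Qed.

Section SphereMeasure.
Variable N : nat.

Definition sphere : set (N.-tuple R) := [set x | enorm (colv x) = 1].

Definition punctured_ball : set (N.-tuple R) :=
  [set y | 0 < enorm (colv y) <= 1].

Definition normalize (y : N.-tuple R) : N.-tuple R :=
  [tuple tnth y i / enorm (colv y) | i < N].

(* Unnormalized surface measure: sphere_measure A is N times the volume of the
   cone {t * x | 0 < t <= 1, x in A} over the part of A on the sphere. *)
Definition sphere_measure (A : set (N.-tuple R)) : \bar R :=
  (N%:R%:E * lebesgueN N (punctured_ball `&` normalize @^-1` A))%E.

Lemma measurable_enorm : measurable_fun setT (fun y => enorm (@colv N y)).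
Proof.
rewrite (_ : (fun y => _) = Num.sqrt \o (fun y => \sum_i tnth y i ^+ 2)).
  apply: measurableT_comp.
    by apply: continuous_measurable_fun; exact: sqrt_continuous.
  apply: measurable_sum => i; apply: measurable_funX; exact: measurable_tnth.
rewrite funeqE => y; rewrite /enorm /dot mxE /=; congr (Num.sqrt _).
by apply: eq_bigr => i _; rewrite !mxE expr2.
Qed.

Lemma measurable_sphere : measurable sphere.
Proof.
rewrite -[X in measurable X]setTI.
exact: (measurable_enorm measurableT (measurable_set1 1)).
Qed.

Lemma measurable_punctured_ball : measurable punctured_ball.
Proof.
rewrite (_ : punctured_ball = setT `&` (fun y => enorm (colv y)) @^-1` `]0, 1]).
  by apply: measurable_enorm.
by rewrite setTI; apply/seteqP; split => y; rewrite /= in_itv.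
Qed.

Lemma measurable_normalize : measurable_fun setT normalize.
Proof.
apply/measurable_fun_tnthP => i.
rewrite (_ : _ \o _ = (fun y => tnth y i * (enorm (colv y))^-1)).
  apply: measurable_funM; first exact: measurable_tnth.
  exact: (measurableT_comp measurable_invr measurable_enorm).
by rewrite funeqE => y; rewrite /= tnth_mktuple.
Qed.

Let sphere_measure0 : sphere_measure set0 = 0%E.
Proof. by rewrite /sphere_measure preimage_set0 setI0 measure0 mule0. Qed.

Let sphere_measure_ge0 A : (0 <= sphere_measure A)%E.
Proof. by rewrite mule_ge0 // lee_fin. Qed.

Let sphere_measure_sigma_additive : semi_sigma_additive sphere_measure.
Proof.
move=> F mF tF mUF; rewrite /sphere_measure.
under eq_fun => n do rewrite -ge0_sume_distrr //.
apply: cvgeZl => //.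
rewrite preimage_bigcup setI_bigcupr.
have mFi A : measurable A -> measurable (punctured_ball `&` normalize @^-1` A).
  move=> mA; apply: measurableI; first exact: measurable_punctured_ball.
  by rewrite -[X in measurable X]setTI; exact: measurable_normalize.
apply: measure_semi_sigma_additive.
- by move=> i; exact: mFi.
- apply/trivIsetP => i j _ _ ij; rewrite setIACA setIid -preimage_setI.
  by move/trivIsetP : tF => /(_ i j I I ij) ->; rewrite preimage_set0 setI0.
- by rewrite -setI_bigcupr -preimage_bigcup; exact: mFi.
Qed.

HB.instance Definition _ := isMeasure.Build _ _ _ sphere_measure
  sphere_measure0 sphere_measure_ge0 sphere_measure_sigma_additive.

End SphereMeasure.

Definition peval (N : nat) (h : {mpoly R[N]}) (x : N.-tuple R) : R :=
  mpoly.meval (tnth x) h.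

Definition Var (N : nat) (w : 'cV[R]_N) (h : {mpoly R[N]}) : R :=
  \int[@sphere_measure N]_(x in @sphere N) (peval h x ^+ 2 * dot w (colv x) ^+ 2).

(* Entrywise integral of h(x)^2 x x^T *)
Definition Cov (N : nat) (h : {mpoly R[N]}) : 'M[R]_N :=
  \matrix_(i, j) \int[@sphere_measure N]_(x in @sphere N)
    (peval h x ^+ 2 * (colv x *m (colv x)^T) i j).

Section PWPCA.
Variables (n : nat) (f : {mpoly R[n]}).

Definition append0 (u : 'cV[R]_n) : 'cV[R]_(n + 1) := col_mx u 0.

Definition is_maximizer (F : 'cV[R]_n -> R) (D : set 'cV[R]_n) (v : 'cV[R]_n) :=
  D v /\ forall u, D u -> F u <= F v.

(* The vectors v_1, ..., v_n are the columns of V. *)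
Definition is_principal_axes (V : 'M[R]_n) : Prop :=
  forall i : 'I_n,
    is_maximizer (fun u => Var (append0 u) (homogenize f))
      [set u | enorm u = 1 /\
               forall j : 'I_n, (j < i)%N -> dot u (col j V) = 0]
      (col i V).

Definition is_PWPCA (lambda : 'rV[R]_n) (V : 'M[R]_n) : Prop :=
  is_principal_axes V /\
  forall i, lambda 0 i = Var (append0 (col i V)) (homogenize f).

End PWPCA.

Definition is_sorted_eigendecomposition (n : nat) (M : 'M[R]_n)
    (lambda : 'rV[R]_n) (V : 'M[R]_n) : Prop :=
  [/\ V^T *m V = 1%:M,
      forall i j : 'I_n, (i <= j)%N -> lambda 0 j <= lambda 0 i
    & M = V *m diag_mx lambda *m V^T].

End EuclideanSpace.

(* Main.v *)
(* The sphere has finite measure and polynomials are bounded on it, so the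
   integral may be exchanged with the expansion of (w^T x)^2; this gives
   Var_[u,0](h) = u^T M u with M the leading principal block of Cov(h). It
   remains to show, for a symmetric M, that successive constrained maximizers of
   u^T M u on the unit sphere are exactly orthonormal eigenbases sorted by
   eigenvalue. *)
Require Import Defs.
From mathcomp Require Import all_boot all_order all_algebra.
From mathcomp Require Import all_classical all_reals all_analysis.
From mathcomp Require Import measurable_realfun lra ring.

Set Implicit Arguments.
Unset Strict Implicit.
Unset Printing Implicit Defensive.

Import Order.TTheory GRing.Theory Num.Theory.

Local Open Scope ring_scope.
Local Open Scope classical_set_scope.

(** * Algebra of the Euclidean inner product *)

Section Dot.
Variables (R : realType) (N : nat).
Implicit Types (u v w : 'cV[R]_N) (t : R).

Lemma dotE u v : dot u v = \sum_i u i 0 * v i 0.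
Proof. by rewrite /dot mxE; apply: eq_bigr => i _; rewrite mxE. Qed.

Lemma dotC u v : dot u v = dot v u.
Proof. by rewrite !dotE; apply: eq_bigr => i _; rewrite mulrC. Qed.

Lemma dotDr u v w : dot u (v + w) = dot u v + dot u w.
Proof. by rewrite /dot mulmxDr mxE. Qed.

Lemma dotZr t u v : dot u (t *: v) = t * dot u v.
Proof. by rewrite /dot -scalemxAr mxE. Qed.

Lemma dotDl u v w : dot (u + v) w = dot u w + dot v w.
Proof. by rewrite dotC dotDr !(dotC w). Qed.

Lemma dotZl t u v : dot (t *: u) v = t * dot u v.
Proof. by rewrite dotC dotZr dotC. Qed.

Lemma dot_ge0 u : 0 <= dot u u.
Proof. by rewrite dotE sumr_ge0 // => i _; rewrite -expr2 sqr_ge0. Qed.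

Lemma dot_mulmxl (M : 'M[R]_N) u v : dot (M *m u) v = dot u (M^T *m v).
Proof. by rewrite /dot trmx_mul mulmxA. Qed.

Lemma enorm_sqr u : enorm u ^+ 2 = dot u u.
Proof. exact/sqr_sqrtr/dot_ge0. Qed.

Lemma enorm_eq1 u : enorm u = 1 <-> dot u u = 1.
Proof.
split=> [u1|u1]; first by rewrite -enorm_sqr u1 expr1n.
by rewrite /enorm u1 sqrtr1.
Qed.

Lemma dot_col (V W : 'M[R]_N) i j : dot (col i V) (col j W) = (V^T *m W) i j.
Proof. by rewrite /dot tr_col -row_mul mxE colE mulmxA -colE mxE. Qed.

End Dot.

(** First-order optimality: at [t = a / (1 + |b|)] the expression is [t ^+ 2] times a positive
    factor, which forces [t], hence [a], to vanish. *)
Lemma quadratic_le0_linear_coef0 (R : realFieldType) (a b : R) :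
  (forall t, 2 * t * a + t ^+ 2 * b <= 0) -> a = 0.
Proof.
move=> le0; have b1_gt0 : 0 < 1 + `|b| by rewrite ltr_pwDl.
have /(_ (a / (1 + `|b|))) := le0.
rewrite (_ : _ + _ = (a / (1 + `|b|)) ^+ 2 * (2 * (1 + `|b|) + b)); last first.
  by field; rewrite gt_eqF.
have pos : 0 < 2 * (1 + `|b|) + b.
  by have := ler_norm (- b); rewrite normrN; have := normr_ge0 b; lra.
rewrite pmulr_lle0 // => sq_le0.
have /eqP : (a / (1 + `|b|)) ^+ 2 = 0 by apply/le_anti; rewrite sq_le0 sqr_ge0.
by rewrite sqrf_eq0 mulf_eq0 invr_eq0 (gt_eqF b1_gt0) orbF => /eqP.
Qed.

(** * Successive constrained maximizers of a quadratic form *)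

Section PrincipalAxes.
Variables (R : realType) (n : nat) (M : 'M[R]_n).
Hypothesis symM : M^T = M.
Implicit Types (V : 'M[R]_n) (u w : 'cV[R]_n).

Definition quad u : R := dot u (M *m u).

(** Written exactly as the constraint set in [is_principal_axes], so that the two agree by
    conversion. *)
Definition admissible V (i : 'I_n) : set 'cV[R]_n :=
  [set u | enorm u = 1 /\ forall j : 'I_n, (j < i)%N -> dot u (col j V) = 0].

(** Both sides are homogeneous of degree 2 in [w], so normalizing [w] reduces to maximality on the
    unit sphere. This form lets perturbations leave the sphere. *)
Lemma maximizer_quad_le V (i : 'I_n) w :
  is_maximizer quad (admissible V i) (col i V) -> 0 < dot w w ->
  (forall j : 'I_n, (j < i)%N -> dot w (col j V) = 0) ->
  quad w <= quad (col i V) * dot w w.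
Proof.
move=> [_ maxi] w_gt0 w_perp.
have e_gt0 : 0 < enorm w by rewrite sqrtr_gt0.
have := maxi ((enorm w)^-1 *: w); rewrite {1}/quad -scalemxAr dotZl dotZr -/(quad w).
rewrite mulrA -expr2 exprVn enorm_sqr mulrC ler_pdivrMr //; apply; split.
  by apply/enorm_eq1; rewrite dotZl dotZr mulrA -expr2 exprVn enorm_sqr mulVf ?gt_eqF.
by move=> j ji; rewrite dotZl w_perp // mulr0.
Qed.

(** Of two distinct columns, the constraint on the later one gives the orthogonality. *)
Lemma admissible_orthogonal V :
  (forall i, admissible V i (col i V)) -> V^T *m V = 1%:M.
Proof.
move=> adm; apply/matrixP => i j; rewrite -dot_col [RHS]mxE.
have [<-|neq_ij] := eqVneq i j; first exact/enorm_eq1/(adm i).1.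
case: (ltngtP i j) => [ij|ij|/val_inj ij].
- by rewrite dotC (adm j).2.
- by rewrite (adm i).2.
- by rewrite ij eqxx in neq_ij.
Qed.

Lemma quad_add_scale u w (t : R) :
  quad (u + t *: w) = quad u + 2 * t * dot u (M *m w) + t ^+ 2 * quad w.
Proof.
have -> : quad (u + t *: w) =
    quad u + t * dot u (M *m w) + (t * dot w (M *m u) + t ^+ 2 * quad w).
  by rewrite /quad mulmxDr -scalemxAr !(dotDl, dotDr, dotZl, dotZr); ring.
(* Symmetry of [M] merges the two cross terms. *)
have -> : dot w (M *m u) = dot u (M *m w) by rewrite dotC dot_mulmxl symM.
by ring.
Qed.

(* Perturb the i-th axis in the direction of the j-th one: the first-order term
   of the quadratic form, [2 t (V^T M V) i j], must vanish at a maximum. *)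
Lemma maximizers_off_diag V (i j : 'I_n) :
  (forall i, is_maximizer quad (admissible V i) (col i V)) ->
  (i < j)%N -> dot (col i V) (M *m col j V) = 0.
Proof.
move=> maxV ij.
have /matrixP orthV := admissible_orthogonal (fun i => (maxV i).1).
have dotV k l : dot (col k V) (col l V) = (k == l)%:R.
  by rewrite dot_col orthV mxE.
have neq_ij : (i == j) = false by rewrite -val_eqE ltn_eqF.
(* The squared norm [1 + t ^+ 2] of the perturbed axis multiplies the maximum [quad (col i V)]; its
   constant part cancels and its [t ^+ 2] part enters this coefficient. *)
apply: (@quadratic_le0_linear_coef0 _ _ (quad (col j V) - quad (col i V))) => t.
have norm_pert : dot (col i V + t *: col j V) (col i V + t *: col j V) = 1 + t ^+ 2.
  rewrite !(dotDl, dotDr, dotZl, dotZr) !dotV !eqxx neq_ij eq_sym neq_ij /=.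
  by ring.
have := maximizer_quad_le (w := col i V + t *: col j V) (maxV i).
rewrite norm_pert quad_add_scale => le_quad.
suff : quad (col i V) + 2 * t * dot (col i V) (M *m col j V)
    + t ^+ 2 * quad (col j V) <= quad (col i V) * (1 + t ^+ 2) by lra.
apply: le_quad; first by rewrite ltr_pwDl // sqr_ge0.
(* As [k < i < j], the perturbed axis stays orthogonal to the earlier ones. *)
move=> k ki; rewrite dotDl dotZl !dotV -!val_eqE /= (gtn_eqF ki).
by rewrite (gtn_eqF (ltn_trans ki ij)) mulr0 addr0.
Qed.

Lemma maximizers_eigendecomposition V (lambda : 'rV[R]_n) :
  (forall i, is_maximizer quad (admissible V i) (col i V)) /\
    (forall i, lambda 0 i = quad (col i V)) <->
  is_sorted_eigendecomposition M lambda V.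
Proof.
split=> [[maxV lamE]|[orthV sortedl defM]].
  have orthV := admissible_orthogonal (fun i => (maxV i).1).
  have orthV' := mulmx1C orthV.
  split=> // [i j|].
    rewrite leq_eqVlt => /predU1P[/val_inj->//|ij]; rewrite !lamE.
    (* A later axis satisfies all constraints of an earlier one, so it competes there. *)
    apply: (maxV i).2; split; first exact: (maxV j).1.1.
    by move=> k ki; apply: (maxV j).1.2; exact: ltn_trans ij.
  (* Writing [M] as [V (V^T M V) V^T] leaves [V^T M V = diag_mx lambda] to check entrywise. *)
  rewrite -[LHS]mul1mx -[LHS]mulmx1 -orthV' !mulmxA; congr (_ *m _).
  rewrite -!mulmxA; congr (_ *m _); apply/matrixP => i j.
  have -> : (V^T *m (M *m V)) i j = dot (col i V) (M *m col j V).
    by rewrite -dot_col !colE mulmxA.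
  rewrite [RHS]mxE; case: (ltngtP i j) => [ij|ij|/val_inj <-].
  - by rewrite maximizers_off_diag // -val_eqE (ltn_eqF ij).
  - rewrite -{1}symM -dot_mulmxl dotC maximizers_off_diag //.
    by rewrite -val_eqE (gtn_eqF ij).
  - by rewrite eqxx lamE.
have orthV' := mulmx1C orthV.
(* Converse: in the coordinates [V^T u] the form is diagonal. *)
have quadE u : quad u = \sum_k lambda 0 k * (V^T *m u) k 0 ^+ 2.
  rewrite /quad defM -!mulmxA dotC dot_mulmxl dotE; apply: eq_bigr => k _.
  by rewrite mul_diag_mx [X in X * _]mxE -mulrA expr2.
have coordE u k : (V^T *m u) k 0 = dot (col k V) u.
  by rewrite /dot tr_col -row_mul [RHS]mxE.
have dotV k l : dot (col k V) (col l V) = (k == l)%:R.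
  by rewrite dot_col orthV mxE.
have quad_col i : quad (col i V) = lambda 0 i.
  rewrite quadE (bigD1 i) //= coordE dotV eqxx expr1n mulr1 big1 ?addr0 //.
  by move=> k ki; rewrite coordE dotV (negbTE ki) expr0n mulr0.
split=> [i|i]; last by rewrite quad_col.
split=> [|u [/enorm_eq1 u1 u_perp]].
  split=> [|j ji]; first by apply/enorm_eq1; rewrite dotV eqxx.
  by rewrite dotV -val_eqE (gtn_eqF ji).
have sum1 : \sum_k (V^T *m u) k 0 ^+ 2 = 1.
  rewrite -u1 -{3}[u]mul1mx -orthV' -mulmxA dotC dot_mulmxl dotE.
  by apply: eq_bigr.
(* The coordinates have unit norm; those before [i] vanish by the constraints, and the others carry
   weights at most [lambda 0 i]. *)
rewrite quad_col quadE -[leRHS]mulr1 -sum1 mulr_sumr; apply: ler_sum => k _.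
have [ki|ik] := ltnP k i.
  by rewrite coordE dotC u_perp // expr0n !mulr0.
by rewrite ler_wpM2r ?sqr_ge0 // sortedl.
Qed.

End PrincipalAxes.

(** * Finiteness of the sphere measure and integrability of polynomials *)

Section SphereIntegral.
Variable R : realType.

Lemma normr_tnth_le_enorm (N : nat) (x : N.-tuple R) i :
  `|tnth x i| <= enorm (colv x).
Proof.
rewrite -(@ler_pXn2r _ 2) ?nnegrE ?sqrtr_ge0 //.
rewrite real_normK ?num_real // enorm_sqr dotE (bigD1 i) //= mxE -expr2 lerDl.
by rewrite sumr_ge0 // => j _; rewrite -expr2 sqr_ge0.
Qed.

(** A product set enclosing the punctured ball, so that finite volume follows by induction on
    [N]. *)
Definition cube N : set (N.-tuple R) :=
  [set x | forall i, `|tnth x i| <= 1].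

Lemma measurable_cube N : measurable (@cube N).
Proof.
rewrite (_ : @cube N = \bigcap_(i in [set: 'I_N]) ((@tnth N R)^~ i @^-1` `[-1, 1])).
  apply: fin_bigcap_measurable => [|i _]; first exact: finite_finset.
  by rewrite -[X in measurable X]setTI; exact: measurable_tnth.
apply/seteqP; split => [x cx i _|x cx i].
  by rewrite /preimage /= in_itv /= -ler_norml.
by have := cx i I; rewrite /preimage /= in_itv /= -ler_norml.
Qed.

Lemma lebesgueN_cube_fin N : (lebesgueN R N (@cube N) < +oo)%E.
Proof.
elim: N => [|k IHk] /=; first by rewrite diracE ltey.
rewrite /cons_measure /pushforward.
rewrite (_ : _ @^-1` _ = `[-1, 1]%classic `*` @cube k); last first.
  apply/seteqP; split => [[a x] /= cx|[a x] [/= a1 cx] i].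
    split=> /=; first by rewrite in_itv /= -ler_norml; exact: (cx ord0).
    by move=> i; have := cx (lift ord0 i); rewrite tnthS.
  case: (unliftP ord0 i) => [j|] ->; first by rewrite tnthS; exact: cx.
  by move: a1; rewrite in_itv /= -ler_norml.
rewrite product_measure1E //; last exact: measurable_cube.
rewrite lte_mul_pinfty // ?ge0_fin_numE //.
suff : (@lebesgue_measure R `[(-1)%R, 1%R] < +oo)%E by [].
by rewrite lebesgue_measure_itv /=; case: ifP; rewrite ?ltey.
Qed.

Lemma sphere_measure_fin N : (sphere_measure (@sphere R N) < +oo)%E.
Proof.
rewrite /sphere_measure lte_mul_pinfty //.
apply: le_lt_trans (lebesgueN_cube_fin N); apply: le_measure.
- rewrite inE; apply: measurableI; first exact: measurable_punctured_ball.
  rewrite -[X in measurable X]setTI.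
  by apply: measurable_normalize => //; exact: measurable_sphere.
- by rewrite inE; exact: measurable_cube.
move=> x [/andP[_ x1] _] i; exact: le_trans (normr_tnth_le_enorm x i) x1.
Qed.

Lemma measurable_peval N (h : {mpoly R[N]}) : measurable_fun setT (peval h).
Proof.
rewrite /peval; under eq_fun do rewrite mpoly.mevalE.
apply: measurable_sum => m; apply: measurable_funM => //.
apply: measurable_prod => i _; apply: measurable_funX; exact: measurable_tnth.
Qed.

Lemma peval_sphere_bounded N (h : {mpoly R[N]}) :
  exists C, forall x, sphere x -> `|peval h x| <= C.
Proof.
(* Coordinates on the sphere are at most 1 in absolute value, hence so are monomials. *)
exists (\sum_(m <- mpoly.msupp h) `|mpoly.mcoeff m h|) => x x1.
rewrite /peval mpoly.mevalE; apply: le_trans (ler_norm_sum _ _ _) _.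
apply: ler_sum => m _; rewrite normrM ler_piMr // normr_prod.
rewrite prodr_ile1 // => i _; rewrite normrX exprn_ge0 ?exprn_ile1 //.
by rewrite -x1 normr_tnth_le_enorm.
Qed.

Lemma integrable_moment N (h : {mpoly R[N]}) i j :
  (@sphere_measure R N).-integrable (@sphere R N)
    (EFin \o (fun x => peval h x ^+ 2 * (tnth x i * tnth x j))).
Proof.
apply: measurable_bounded_integrable.
- exact: measurable_sphere.
- exact: sphere_measure_fin.
- apply: measurable_funTS; apply: measurable_funM.
    by apply: measurable_funX; exact: measurable_peval.
  by apply: measurable_funM; exact: measurable_tnth.
have [C hC] := peval_sphere_bounded h.
exists (C ^+ 2); split; first exact: num_real.
move=> B CB x x1 /=; apply: le_trans (ltW CB).
rewrite normrM normrX -[leRHS]mulr1 ler_pM ?exprn_ge0 //.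
  by rewrite lerXn2r ?nnegrE ?hC // (le_trans _ (hC x x1)).
by rewrite normrM mulr_ile1 // -x1 normr_tnth_le_enorm.
Qed.

(** Integrability makes each extended-real integral finite, so [fine] commutes with the sum. *)
Lemma Rintegral_sum d (T : measurableType d) (mu : {measure set T -> \bar R})
    (D : set T) (I : Type) (s : seq I) (f : I -> T -> R) :
  measurable D -> (forall i, mu.-integrable D (EFin \o f i)) ->
  \int[mu]_(x in D) (\sum_(i <- s) f i x) = \sum_(i <- s) \int[mu]_(x in D) f i x.
Proof.
move=> mD intf; rewrite /Rintegral; under eq_integral do rewrite -sumEFin.
rewrite (integral_sum mD intf) -sum_fine // => i _.
exact: integrable_fin_num.
Qed.

(** * Variance as the quadratic form of the covariance matrix *)

Lemma CovE N (h : {mpoly R[N]}) i j :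
  Cov h i j = \int[@sphere_measure R N]_(x in @sphere R N)
    (peval h x ^+ 2 * (tnth x i * tnth x j)).
Proof.
rewrite mxE; apply: eq_Rintegral => x _.
by rewrite mxE big_ord1 !mxE.
Qed.

Lemma tr_Cov N (h : {mpoly R[N]}) : (Cov h)^T = Cov h.
Proof.
apply/matrixP => i j; rewrite mxE !CovE.
by apply: eq_Rintegral => x _; rewrite (mulrC (tnth x j)).
Qed.

Lemma Var_Cov N (w : 'cV[R]_N) (h : {mpoly R[N]}) :
  Var w h = dot w (Cov h *m w).
Proof.
(* Expanding the squared inner product gives a finite double sum of integrable moments. *)
transitivity (\int[@sphere_measure R N]_(x in @sphere R N)
  \sum_i \sum_j (w i 0 * w j 0 * (peval h x ^+ 2 * (tnth x i * tnth x j)))).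
  apply: eq_Rintegral => x _; rewrite dotE [X in _ * X]expr2 big_distrlr mulr_sumr.
  apply: eq_bigr => i _; rewrite mulr_sumr; apply: eq_bigr => j _.
  by rewrite /= !mxE; ring.
have mS := @measurable_sphere R N.
have int_ij i j : (@sphere_measure R N).-integrable (@sphere R N)
    (EFin \o (fun x => w i 0 * w j 0 * (peval h x ^+ 2 * (tnth x i * tnth x j)))).
  exact: (integrableZl mS _ (integrable_moment h i j)).
rewrite Rintegral_sum //; last first.
  move=> i; rewrite /comp; under eq_fun do rewrite -sumEFin.
  by apply: (integrable_sum mS) => j _; exact: int_ij.
rewrite dotE; apply: eq_bigr => i _; rewrite Rintegral_sum // mxE mulr_sumr.
apply: eq_bigr => j _; rewrite RintegralZl //; last exact: integrable_moment.
by rewrite CovE -mulrA [w j 0 * _]mulrC.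
Qed.

(** The appended zero annihilates every block of [Cov h] but the upper left one. *)
Lemma Var_append0 n (u : 'cV[R]_n) (h : {mpoly R[n + 1]}) :
  Var (append0 u) h = dot u (ulsubmx (Cov h) *m u).
Proof.
rewrite Var_Cov -{1}[Cov h]submxK /append0 mul_block_col !mulmx0 !addr0.
by rewrite /dot tr_col_mx mul_row_col trmx0 mul0mx addr0.
Qed.

End SphereIntegral.

Theorem proposition9 (R : realType) (n : nat) (f : {mpoly R[n]})
    (lambda : 'rV[R]_n) (V : 'M[R]_n) :
  is_PWPCA f lambda V <->
  is_sorted_eigendecomposition (ulsubmx (Cov (homogenize f))) lambda V.
Proof.
set M := ulsubmx _.
have symM : M^T = M by rewrite /M trmx_ulsub tr_Cov.
rewrite -(maximizers_eigendecomposition symM) /is_PWPCA /is_principal_axes.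
(* Equality of functions is needed, since the objective is an argument of [is_maximizer]. *)
have -> : (fun u => Var (append0 u) (homogenize f)) = quad M.
  by apply/funext => u; rewrite Var_append0.
suff -> : (forall i, lambda 0 i = Var (append0 (col i V)) (homogenize f)) =
    (forall i, lambda 0 i = quad M (col i V)) by [].
by apply: eq_forall => i; rewrite Var_append0.
Qed.
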